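(* For every $\varepsilon \in (0,1)$ there exists a constant $D = D(\varepsilon)$, depending only on $\varepsilon$ and not on the dimension, such that for every integer $n \ge 1$ the following holds. Let $K_n \subset \mathbb{R}^n$ be an $n$-dimensional cube of unit volume, and let $A$ and $B$ be subsets of $K_n$, each of $n$-dimensional volume $\varepsilon$, such that each of $A$ and $B$ is the intersection of $K_n$ with a half-space whose bounding hyperplane is perpendicular to the main diagonal of $K_n$ (the same main diagonal for $A$ and $B$). Then $\mathrm{dist}(A, B) \le D$.
   Context: For sets $A, B \subset \mathbb{R}^n$, $\mathrm{dist}(A,B) = \inf_{X \in A,\, Y \in B} \mathrm{dist}(X,Y)$, where $\mathrm{dist}(X,Y)$ is the Euclidean distance between the points $X$ and $Y$. Volume means $n$-dimensional Lebesgue measure. A main diagonal of a cube is a segment joining two opposite vertices; for $K_n = [0,1]^n$ one may take the diagonal joining $(0,\ldots,0)$ and $(1,\ldots,1)$. *)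

(* Defs.v *)
From HB Require Import structures.
From mathcomp Require Import all_boot all_order all_algebra.
From mathcomp Require Import all_classical all_reals all_analysis.

Set Implicit Arguments.
Unset Strict Implicit.
Unset Printing Implicit Defensive.

Import Order.TTheory GRing.Theory Num.Theory.
Import numFieldNormedType.Exports.

Local Open Scope classical_set_scope.
Local Open Scope ring_scope.

Lemma sigma_finite_product d1 d2 (T1 : measurableType d1)
    (T2 : measurableType d2) (R : realType)
    (m1 : {sigma_finite_measure set T1 -> \bar R})
    (m2 : {sigma_finite_measure set T2 -> \bar R}) :
  sigma_finite setT (m1 \x m2)%E.
Proof.
have /sigma_finiteP[F [TF ndF Foo]] := sigma_finiteT m1.
have /sigma_finiteP[G [TG ndG Goo]] := sigma_finiteT m2.
exists (fun k => F k `*` G k).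
  rewrite -setXTT TF TG predeqE => -[x y]; split.
    move=> [/= [k _ Fkx] [l _ Gly]]; exists (maxn k l) => //; split.
    - by move: x Fkx; exact/subsetPset/ndF/leq_maxl.
    - by move: y Gly; exact/subsetPset/ndG/leq_maxr.
  by move=> [k _ []/= ? ?]; split; exists k.
move=> k; have [? ?] := Foo k; have [? ?] := Goo k.
split; first exact: measurableX.
by rewrite product_measure1E// lte_mul_pinfty// ge0_fin_numE.
Qed.

Section cons_measure.
Context d (T : measurableType d) (R : realType) (n : nat).
Variable m1 : {sigma_finite_measure set T -> \bar R}.
Variable m2 : {sigma_finite_measure set (n.-tuple T) -> \bar R}.

Let tcons (x : T * n.-tuple T) : n.+1.-tuple T := [tuple of x.1 :: x.2].

Definition cons_measure : set (n.+1.-tuple T) -> \bar R :=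
  pushforward (m1 \x m2)%E tcons.

Let measurable_tcons : measurable_fun setT tcons.
Proof. exact: measurable_cons. Qed.

Let measurable_preimage A : measurable A -> measurable (tcons @^-1` A).
Proof. by move=> mA; rewrite -[_ @^-1` _]setTI; exact: measurable_tcons. Qed.

Let cons_measure0 : cons_measure set0 = 0%E.
Proof. by rewrite /cons_measure /pushforward preimage_set0 measure0. Qed.

Let cons_measure_ge0 A : (0 <= cons_measure A)%E.
Proof. exact: measure_ge0. Qed.

Let cons_measure_sigma_additive : semi_sigma_additive cons_measure.
Proof.
move=> F mF tF mUF; rewrite /cons_measure /pushforward preimage_bigcup.
apply: measure_semi_sigma_additive.
- by move=> k; exact: measurable_preimage.
- apply/trivIsetP => /= i j _ _ ij; rewrite -preimage_setI.
  by move/trivIsetP : tF => /(_ _ _ _ _ ij) ->//; rewrite preimage_set0.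
- by rewrite -preimage_bigcup; exact: measurable_preimage.
Qed.

HB.instance Definition _ := isMeasure.Build _ _ _ cons_measure
  cons_measure0 cons_measure_ge0 cons_measure_sigma_additive.

Let tuncons (t : n.+1.-tuple T) : T * n.-tuple T :=
  (thead t, [tuple of behead t]).

Let measurable_tuncons : measurable_fun setT tuncons.
Proof.
apply: measurable_fun_pair; last exact: measurable_behead.
exact: measurable_tnth.
Qed.

Let tconsK : cancel tcons tuncons.
Proof. by case=> x t; congr pair; apply/val_inj. Qed.

Let sigma_finite_cons_measure : sigma_finite setT cons_measure.
Proof.
have [F UF mF] := sigma_finite_product m1 m2.
exists (fun k => tuncons @^-1` F k).
  by rewrite -preimage_bigcup -UF preimage_setT.
move=> k; have [mFk Fk] := mF k; split.
  by rewrite -[_ @^-1` _]setTI; exact: measurable_tuncons.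
rewrite /cons_measure /pushforward -comp_preimage.
by rewrite (_ : tuncons \o tcons = id)//; apply/funext => x; exact: tconsK.
Qed.

HB.instance Definition _ := Measure_isSigmaFinite.Build _ _ _ cons_measure
  sigma_finite_cons_measure.

End cons_measure.

Fixpoint lebesgue_tuple (R : realType) (n : nat) :
    {sigma_finite_measure set (n.-tuple (measurableTypeR R)) -> \bar R} :=
  match n with
  | 0 => \d_[tuple]
  | n.+1 => cons_measure (@lebesgue_measure R) (lebesgue_tuple R n)
  end.

(* Only meaningful for Borel sets: [lebesgue_tuple] is not completed. *)
Definition volume (R : realType) (n : nat) (S : set 'rV[R]_n) : \bar R :=
  lebesgue_tuple R n [set t | S (\row_i tnth t i)].

Definition dotp (R : realType) (n : nat) (x y : 'rV[R]_n) : R :=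
  \sum_i x 0 i * y 0 i.

(* The library norm on ['rV_n] is the sup norm. *)
Definition eucl_dist (R : realType) (n : nat) (x y : 'rV[R]_n) : R :=
  Num.sqrt (dotp (x - y) (x - y)).

(* Extended-real valued, so that the distance to the empty set is [+oo]. *)
Definition set_dist (R : realType) (n : nat) (A B : set 'rV[R]_n) : \bar R :=
  ereal_inf [set r | exists x y, [/\ A x, B y & r = (eucl_dist x y)%:E]].

Definition hyperplane (R : realType) (n : nat) (w : 'rV[R]_n) (c : R) :
  set 'rV[R]_n := [set x | dotp x w = c].

(* The half-spaces on the other side of [hyperplane w c] are obtained by
   negating both [w] and [c]. *)
Definition half_space (R : realType) (n : nat) (w : 'rV[R]_n) (c : R)
    (H : set 'rV[R]_n) : Prop :=
  w != 0 /\ (H = [set x | dotp x w <= c] \/ H = [set x | dotp x w < c]).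

Definition perpendicular (R : realType) (n : nat) (P : set 'rV[R]_n)
    (a b : 'rV[R]_n) : Prop :=
  forall x y, P x -> P y -> dotp (x - y) (b - a) = 0.

(* The rows of [frame] are the unit edge directions; the cube need not be
   parallel to the axes. *)
Record cube (R : realType) (n : nat) := Cube {
  corner : 'rV[R]_n;
  side : R;
  frame : 'M[R]_n;
  side_gt0 : 0 < side;
  frame_orthogonal : frame *m frame^T = 1%:M }.

Definition cube_point (R : realType) (n : nat) (K : cube R n) (t : 'rV[R]_n) :
  'rV[R]_n := corner K + side K *: (t *m frame K).

Definition cube_set (R : realType) (n : nat) (K : cube R n) : set 'rV[R]_n :=
  cube_point K @` [set t : 'rV[R]_n | forall i, 0 <= t 0 i <= 1].

Definition cube_vertex (R : realType) (n : nat) (K : cube R n)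
    (v : {set 'I_n}) : 'rV[R]_n :=
  cube_point K (\row_i (i \in v)%:R).

Definition main_diagonal (R : realType) (n : nat) (K : cube R n)
    (a b : 'rV[R]_n) : Prop :=
  exists v : {set 'I_n}, a = cube_vertex K v /\ b = cube_vertex K (~: v)%SET.

Definition perpendicular_cap (R : realType) (n : nat) (K : cube R n)
    (a b : 'rV[R]_n) (S : set 'rV[R]_n) : Prop :=
  exists (w : 'rV[R]_n) (c : R) (H : set 'rV[R]_n),
    [/\ half_space w c H, perpendicular (hyperplane w c) a b &
        S = cube_set K `&` H].

(* Main.v *)
Require Import Defs.
From HB Require Import structures.
From mathcomp Require Import all_boot all_order all_algebra.
From mathcomp Require Import all_classical all_reals all_analysis.
From mathcomp Require Import measurable_realfun.
From mathcomp Require Import ring lra.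

(* Writing the unit cube as the isometric image of [0,1]^n, a cap orthogonal to
   the diagonal is a half-line condition on X = sum_i e_i (t_i - 1/2) with signs
   e_i.  The second moment of X is n/12, so by Chebyshev the cap, having volume
   eps, must contain one of the two points of the diagonal at distance 1/eps on
   either side of the centre (one of the two endpoints, if the diagonal is
   shorter than that).  Hence both caps meet a piece of the
   diagonal of length at most 2/eps.
   Lebesgue measure is invariant under an orthogonal M because computing the
   integral of f(xM) g(xM + y) over x and y in both orders gives
   (int f(xM) dx) (int g) = (int g(xM) dx) (int f(-y) dy); take for g the
   indicator of a ball, which M preserves. *)

Set Implicit Arguments.
Unset Strict Implicit.
Unset Printing Implicit Defensive.

Import Order.TTheory GRing.Theory Num.Theory.
Import numFieldNormedType.Exports.

Local Open Scope classical_set_scope.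
Local Open Scope ring_scope.

(** * Integration on tuples, translations *)

Section lebesgue_tuple_integration.
Context {R : realType}.
Local Open Scope ereal_scope.

Local Notation Borel := (measurableTypeR R).
Local Notation mu := (@lebesgue_measure R).

Lemma integral_lebesgue_tuple0 (f : 0.-tuple Borel -> \bar R) :
  measurable_fun setT f -> \int[lebesgue_tuple R 0]_t f t = f [tuple].
Proof. by move=> mf; rewrite integral_dirac// diracT mul1e. Qed.

(** [lebesgue_tuple R n.+1] is the image of a product measure under consing, so this is a change of
    variables followed by Tonelli. *)
Lemma integral_lebesgue_tupleS n (f : n.+1.-tuple Borel -> \bar R) :
  measurable_fun setT f -> (forall t, 0 <= f t) ->
  \int[lebesgue_tuple R n.+1]_t f t =
  \int[mu]_x \int[lebesgue_tuple R n]_t f [tuple of x :: t].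
Proof.
move=> mf f0.
have mc : measurable_fun setT
    (fun x : Borel * n.-tuple Borel =>
      [tuple of x.1 :: x.2] : n.+1.-tuple Borel).
  exact: measurable_cons.
transitivity (\int[pushforward (mu \x lebesgue_tuple R n)
    (fun x : Borel * n.-tuple Borel => [tuple of x.1 :: x.2])]_t f t).
  exact: eq_measure_integral.
rewrite ge0_integral_pushforward// fubini_tonelli1//=.
exact: measurableT_comp.
Qed.

Lemma measurable_integral_cons n (f : n.+1.-tuple Borel -> \bar R) :
  measurable_fun setT f -> (forall t, 0 <= f t) ->
  measurable_fun setT (fun x => \int[lebesgue_tuple R n]_t f [tuple of x :: t]).
Proof.
move=> mf f0.
apply: (@measurable_fun_fubini_tonelli_F _ _ Borel (n.-tuple Borel) R
  (lebesgue_tuple R n) (fun x => f [tuple of x.1 :: x.2])) => //.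
by apply: (measurableT_comp mf); exact: measurable_cons.
Qed.

(** The image measure agrees with [mu] on half-open intervals, and these determine Lebesgue
    measure. *)
Lemma lebesgue_measureD (c : R) (A : set R) : measurable A ->
  pushforward mu (+%R c : _ -> Borel) A = mu A.
Proof.
move=> mA; have mc : measurable_fun setT (+%R c : Borel -> Borel).
  exact: measurable_funD.
apply/esym/lebesgue_measure_unique => // _ [[a b]] _ <-.
rewrite [RHS](_ : _ = mu `](a - c)%R, (b - c)%R]%classic); last first.
  congr (mu _); apply/seteqP.
  by split => x /=; rewrite !in_itv/= ltrBlDl lerBrDl.
rewrite !lebesgue_measure_itv/= !lte_fin ltrD2r.
by case: ifPn => // _; congr (_%:E); ring.
Qed.

Lemma ge0_integral_translate (c : R) (f : Borel -> \bar R) :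
  measurable_fun setT f -> (forall x, 0 <= f x) ->
  \int[mu]_x f (c + x)%R = \int[mu]_x f x.
Proof.
move=> mf f0.
have mc : measurable_fun setT (+%R c : Borel -> Borel) by exact: measurable_funD.
rewrite -[LHS](@ge0_integral_pushforward _ _ Borel Borel R (+%R c) mc mu setT)//.
by apply: eq_measure_integral => A mA _; exact: lebesgue_measureD.
Qed.

Definition translate_tuple n (c : 'I_n -> R) (t : n.-tuple Borel) :
  n.-tuple Borel := [tuple c i + tnth t i | i < n]%R.

Lemma measurable_translate_tuple n (c : 'I_n -> R) :
  measurable_fun setT (translate_tuple c).
Proof.
apply/measurable_fun_tnthP => i; rewrite /comp/=.
under eq_fun do rewrite tnth_mktuple.
by apply: measurable_funD => //; exact: measurable_tnth.
Qed.

Lemma translate_tuple_cons n (c : 'I_n.+1 -> R) x (t : n.-tuple Borel) :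
  translate_tuple c [tuple of x :: t] =
  [tuple of (c ord0 + x)%R :: translate_tuple (c \o lift ord0) t].
Proof.
apply: eq_from_tnth => i; rewrite tnth_mktuple.
by case: (unliftP ord0 i) => [j|] ->; rewrite ?tnthS ?tnth_mktuple.
Qed.

(** Induction on [n]: the first coordinate is handled by one-dimensional invariance, the remaining
    ones by the induction hypothesis. *)
Lemma ge0_integral_translate_tuple n (c : 'I_n -> R)
    (f : n.-tuple Borel -> \bar R) :
  measurable_fun setT f -> (forall t, 0 <= f t) ->
  \int[lebesgue_tuple R n]_t f (translate_tuple c t) =
  \int[lebesgue_tuple R n]_t f t.
Proof.
elim: n c f => [|n IH] c f mf f0.
  by apply: eq_integral => t _; congr f; apply: eq_from_tnth => -[].
rewrite !integral_lebesgue_tupleS//; last first.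
  exact: measurableT_comp (measurable_translate_tuple c).
rewrite -[RHS](ge0_integral_translate (c ord0)); last 2 first.
- exact: measurable_integral_cons.
- by move=> x; exact: integral_ge0.
apply: eq_integral => x _ /=.
under eq_integral do rewrite translate_tuple_cons.
rewrite (IH _ (fun t => f [tuple of (c ord0 + x)%R :: t]))//.
by apply: (measurableT_comp mf); exact: measurable_cons.
Qed.

End lebesgue_tuple_integration.

(** * Orthogonal invariance *)

Section orthogonal_invariance.
Context {R : realType}.
Local Open Scope ereal_scope.

Local Notation Borel := (measurableTypeR R).
Local Notation mu := (@lebesgue_measure R).

(** The product of a row vector with [M], on tuples because the measure lives there. *)
Definition mulmx_tuple n (M : 'M[R]_n) (t : n.-tuple Borel) : n.-tuple Borel :=
  [tuple \sum_j tnth t j * M j i | i < n]%R.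

Definition opp_tuple n (t : n.-tuple Borel) : n.-tuple Borel :=
  [tuple - tnth t i | i < n]%R.

Lemma measurable_mktuple d (T : measurableType d) n (f : 'I_n -> T -> R) :
  (forall i, measurable_fun setT (f i)) ->
  measurable_fun setT (fun x => [tuple f i x | i < n] : n.-tuple Borel).
Proof.
move=> mf; apply/measurable_fun_tnthP => i; rewrite /comp/=.
by under eq_fun do rewrite tnth_mktuple; exact: mf.
Qed.

Lemma measurable_mulmx_tuple n (M : 'M[R]_n) :
  measurable_fun setT (mulmx_tuple M).
Proof.
apply: measurable_mktuple => i; apply: measurable_sum => j.
by apply: measurable_funM => //; exact: measurable_tnth.
Qed.

Lemma measurable_opp_tuple n :
  measurable_fun setT (@opp_tuple n).
Proof.
apply: measurable_mktuple => i.
by apply: measurable_funN; exact: measurable_tnth.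
Qed.

Lemma measurable_translate_tuple2 d (T : measurableType d) n
    (u v : T -> n.-tuple Borel) :
  measurable_fun setT u -> measurable_fun setT v ->
  measurable_fun setT (fun x => translate_tuple (tnth (u x)) (v x)).
Proof.
move=> mu_ mv; apply: measurable_mktuple => i.
by apply: measurable_funD; [exact: (measurableT_comp (measurable_tnth i) mu_)|
  exact: (measurableT_comp (measurable_tnth i) mv)].
Qed.

Lemma mulmx_tuple_translate n (M : 'M[R]_n) (c : n.-tuple Borel) t :
  mulmx_tuple M (translate_tuple (tnth c) t) =
  translate_tuple (tnth (mulmx_tuple M c)) (mulmx_tuple M t).
Proof.
apply: eq_from_tnth => i; rewrite !tnth_mktuple -big_split/=.
by apply: eq_bigr => j _; rewrite !tnth_mktuple mulrDl.
Qed.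

Lemma row_mulmx_tuple n (M : 'M[R]_n) (t : n.-tuple Borel) :
  \row_i tnth (mulmx_tuple M t) i = (\row_i tnth t i *m M)%R.
Proof.
apply/rowP => i; rewrite !mxE tnth_mktuple.
by apply: eq_bigr => j _; rewrite !mxE.
Qed.

Lemma row_tuple_inj n : injective (fun t : n.-tuple R => \row_i tnth t i)%R.
Proof.
move=> s t st; apply: eq_from_tnth => i.
by have /rowP/(_ i) := st; rewrite !mxE.
Qed.

Lemma mulmx_tupleM n (M N : 'M[R]_n) t :
  mulmx_tuple N (mulmx_tuple M t) = mulmx_tuple (M *m N) t.
Proof. by apply: row_tuple_inj; rewrite !row_mulmx_tuple mulmxA. Qed.

Lemma mulmx_tuple1 n (t : n.-tuple Borel) : mulmx_tuple 1%:M t = t.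
Proof. by apply: row_tuple_inj; rewrite row_mulmx_tuple mulmx1. Qed.

Lemma integral_mulmx_tuple_swap n (M : 'M[R]_n)
    (f g : n.-tuple Borel -> \bar R) :
  (M *m M^T = 1%:M)%R ->
  measurable_fun setT f -> measurable_fun setT g ->
  (forall t, 0 <= f t) -> (forall t, 0 <= g t) ->
  (\int[lebesgue_tuple R n]_x f (mulmx_tuple M x)) *
    (\int[lebesgue_tuple R n]_x g x) =
  (\int[lebesgue_tuple R n]_x g (mulmx_tuple M x)) *
    (\int[lebesgue_tuple R n]_x f (opp_tuple x)).
Proof.
move=> MMT mf mg f0 g0.
have mM := measurable_mulmx_tuple M.
have mfM : measurable_fun setT (fun x => f (mulmx_tuple M x)).
  exact: (measurableT_comp mf mM).
have mgM : measurable_fun setT (fun x => g (mulmx_tuple M x)).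
  exact: (measurableT_comp mg mM).
have mgT c : measurable_fun setT (fun y => g (@translate_tuple R n c y)).
  exact: (measurableT_comp mg (measurable_translate_tuple c)).
have mfN : measurable_fun setT (fun y => f (@opp_tuple n y)).
  exact: (measurableT_comp mf (@measurable_opp_tuple n)).
have mfNT c : measurable_fun setT
    (fun y => f (opp_tuple (@translate_tuple R n c y))).
  exact: (measurableT_comp mfN (measurable_translate_tuple c)).
rewrite -!ge0_integralZr//; try exact: integral_ge0.
(* For fixed x, translating y by xM does not change the integral of [g], so the product is a double
   integral of f(xM) g(xM + y). *)
transitivity (\int[lebesgue_tuple R n]_x \int[lebesgue_tuple R n]_y
    (f (mulmx_tuple M x) * g (translate_tuple (tnth (mulmx_tuple M x)) y))).
  apply: eq_integral => x _.
  by rewrite ge0_integralZl// ge0_integral_translate_tuple.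
rewrite (fubini_tonelli (fun z : n.-tuple Borel * n.-tuple Borel =>
  f (mulmx_tuple M z.1) *
  g (translate_tuple (tnth (mulmx_tuple M z.1)) z.2))); last 2 first.
- apply: emeasurable_funM; first exact: (measurableT_comp mfM).
  apply: (measurableT_comp mg); apply: measurable_translate_tuple2 => //.
  exact: (measurableT_comp mM).
- by move=> z; exact: mule_ge0.
transitivity (\int[lebesgue_tuple R n]_y \int[lebesgue_tuple R n]_x
    (g (mulmx_tuple M x) *
     f (opp_tuple (translate_tuple (tnth (opp_tuple (mulmx_tuple M x))) y)))).
  apply: eq_integral => y _.
  (* Replacing x by x + yM^T turns xM into xM + y, because M^T M = 1; this carries g(xM) f(xM - y)
     to g(xM + y) f(xM). *)
  rewrite -[RHS](ge0_integral_translate_tuple (tnth (mulmx_tuple M^T y)))/=;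
    last 2 first.
  - apply: emeasurable_funM => //; apply: (measurableT_comp mfN).
    apply: measurable_translate_tuple2 => //.
    exact: (measurableT_comp (@measurable_opp_tuple n)).
  - by move=> z; exact: mule_ge0.
  apply: eq_integral => x _.
  rewrite mulmx_tuple_translate mulmx_tupleM.
  rewrite (mulmx1C MMT) mulmx_tuple1 muleC; congr (g _ * f _).
    by apply: eq_from_tnth => i; rewrite !tnth_mktuple; ring.
  by apply: eq_from_tnth => i; rewrite !tnth_mktuple; ring.
rewrite -(fubini_tonelli (fun z : n.-tuple Borel * n.-tuple Borel =>
  g (mulmx_tuple M z.1) *
  f (opp_tuple (translate_tuple (tnth (opp_tuple (mulmx_tuple M z.1))) z.2))));
  last 2 first.
- apply: emeasurable_funM; first exact: (measurableT_comp mgM).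
  apply: (measurableT_comp mfN); apply: measurable_translate_tuple2 => //.
  apply: (measurableT_comp (@measurable_opp_tuple n)).
  exact: (measurableT_comp mM).
- by move=> z; exact: mule_ge0.
(* With x fixed again, the inner integrand is a translate of f(-y), so the integral over y is
   independent of x. *)
apply: eq_integral => x _ /=.
rewrite ge0_integralZl//; congr (_ * _).
exact: (ge0_integral_translate_tuple _ mfN).
Qed.

Definition tuple_box n (a b : R) : set (n.-tuple Borel) :=
  [set t | forall i, (a <= tnth t i <= b)%R].

Lemma measurable_tuple_box n (a b : R) : measurable (@tuple_box n a b).
Proof.
rewrite (_ : tuple_box _ _ = \bigcap_(i in [set: 'I_n])
    ((fun t : n.-tuple Borel => tnth t i) @^-1` `[a, b]%classic)).
  apply: fin_bigcap_measurable => // i _; rewrite -[_ @^-1` _]setTI.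
  exact: measurable_tnth.
by apply/seteqP; split => t /= H i => [_|]; have := H i; rewrite /= in_itv/=; exact.
Qed.

Lemma lebesgue_tupleE n (A : set (n.-tuple Borel)) : measurable A ->
  lebesgue_tuple R n A = \int[lebesgue_tuple R n]_t (\1_A t)%:E.
Proof. by move=> mA; rewrite integral_indic// setIT. Qed.

(** The indicator of a box is the product of the indicator of an interval in the first coordinate
    and that of a box in the others. In dimension 0 the box is the single empty tuple, of mass 1. *)
Lemma lebesgue_tuple_box n (a b : R) : (a <= b)%R ->
  lebesgue_tuple R n (tuple_box a b) = ((b - a) ^+ n)%:E.
Proof.
move=> ab; have mB k := @measurable_tuple_box k a b.
elim: n => [|n IH].
  rewrite /= diracE expr0 (_ : _ \in _ = true)//.
  by apply/mem_set => -[].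
rewrite lebesgue_tupleE// integral_lebesgue_tupleS//=; last first.
  by apply/measurable_EFinP; apply: measurable_indic; exact: mB.
transitivity (\int[mu]_x ((\1_(`[a, b]%classic) x)%:E * ((b - a) ^+ n)%:E)).
  apply: eq_integral => x _; rewrite -IH lebesgue_tupleE// -ge0_integralZl//; last first.
    by apply/measurable_EFinP; apply: measurable_indic; exact: mB.
  apply: eq_integral => t _; rewrite -EFinM !indicE -natrM mulnb.
  congr (_%:R%:E); congr nat_of_bool; apply/idP/andP.
    move=> /set_mem H; split; apply/mem_set.
      by rewrite /= in_itv; exact: (H ord0).
    by move=> i; have := H (lift ord0 i); rewrite tnthS.
  move=> [/set_mem/= xab /set_mem H]; apply/mem_set => i.
  by case: (unliftP ord0 i) => [j|] ->; rewrite ?tnthS//; rewrite in_itv in xab.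
rewrite ge0_integralZr//; last 2 first.
- by apply/measurable_EFinP; exact: measurable_indic.
- by rewrite lee_fin exprn_ge0// subr_ge0.
rewrite integral_indic// setIT.
rewrite [X in X * _](lebesgue_measure_itv `[a, b])/= lte_fin exprS EFinM.
by case: ltgtP ab => // -> _; rewrite subrr.
Qed.

(** Here [r] is the square of the radius. *)
Definition tuple_ball n (r : R) : set (n.-tuple Borel) :=
  [set t | \sum_i tnth t i ^+ 2 <= r]%R.

Lemma measurable_tuple_ball n r : measurable (@tuple_ball n r).
Proof.
rewrite (_ : tuple_ball r = (fun t : n.-tuple Borel => \sum_i tnth t i ^+ 2)%R
  @^-1` `]-oo, r]%classic); last by apply/seteqP; split => t /=; rewrite in_itv.
rewrite -[_ @^-1` _]setTI.
suff : measurable_fun setT (fun t : n.-tuple Borel => \sum_i tnth t i ^+ 2 : R)%R.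
  by apply.
by apply: measurable_sum => i; apply: measurable_funX; exact: measurable_tnth.
Qed.

(** With squared radius n the ball contains $[0,1]^n$ and is contained in $[-n,n]^n$, since $t_i^2
    \le n \le n^2$; this covers n = 0 as well. *)
Lemma lebesgue_tuple_ball n :
  0 < lebesgue_tuple R n (tuple_ball n%:R) < +oo.
Proof.
have mB := @measurable_tuple_ball n n%:R; apply/andP; split.
  apply: (@lt_le_trans _ _ (lebesgue_tuple R n (tuple_box 0 1))).
    by rewrite lebesgue_tuple_box// subr0 expr1n.
  apply: le_measure; rewrite ?inE//; first exact: measurable_tuple_box.
  move=> t tb; rewrite /tuple_ball/= -[n in n%:R]card_ord -sumr_const.
  by apply: ler_sum => i _; have /andP[t0 t1] := tb i; rewrite exprn_ile1.
apply: (@le_lt_trans _ _ (lebesgue_tuple R n (tuple_box (- n%:R) n%:R))); last first.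
  by rewrite lebesgue_tuple_box ?ltry// (@le_trans _ _ 0%R)// lerNl oppr0.
apply: le_measure; rewrite ?inE//; first exact: measurable_tuple_box.
move=> t tb i; rewrite -ler_norml -ler_sqr ?nnegrE// real_normK ?num_real//.
apply: (@le_trans _ _ n%:R).
  apply: le_trans tb; rewrite (bigD1 i)//= lerDl.
  by apply: sumr_ge0 => j _; exact: sqr_ge0.
by rewrite -natrX ler_nat; case: (n) => // k; rewrite leq_pmulr.
Qed.

Lemma tuple_ball_mulmx n (M : 'M[R]_n) r (t : n.-tuple Borel) :
  (M *m M^T = 1%:M)%R -> tuple_ball r (mulmx_tuple M t) = tuple_ball r t.
Proof.
move=> MMT; rewrite /tuple_ball/=; congr (_ <= _)%R.
have E (s : n.-tuple R) : (\sum_i tnth s i ^+ 2 =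
    ((\row_i tnth s i) *m (\row_i tnth s i)^T) 0 0)%R.
  by rewrite !mxE; apply: eq_bigr => i _; rewrite !mxE.
by rewrite !E row_mulmx_tuple trmx_mul mulmxA -(mulmxA _ M) MMT mulmx1.
Qed.

Lemma ge0_integral_mulmx_tuple n (M : 'M[R]_n) (f : n.-tuple Borel -> \bar R) :
  (M *m M^T = 1%:M)%R -> measurable_fun setT f -> (forall t, 0 <= f t) ->
  \int[lebesgue_tuple R n]_x f (mulmx_tuple M x) =
  \int[lebesgue_tuple R n]_x f x.
Proof.
move=> MMT mf f0.
(* The right-hand side does not involve [N], so comparing N = M with N = 1 gives the claim. *)
suff H (N : 'M[R]_n) : (N *m N^T = 1%:M)%R ->
    \int[lebesgue_tuple R n]_x f (mulmx_tuple N x) =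
    \int[lebesgue_tuple R n]_x f (opp_tuple x).
  rewrite H// -(H 1%:M) ?trmx1 ?mulmx1//.
  by apply: eq_integral => x _; rewrite mulmx_tuple1.
move=> NNT; pose B := @tuple_ball n n%:R.
have mB : measurable B by exact: measurable_tuple_ball.
have mg : measurable_fun setT (fun t => (\1_B t)%:E : \bar R).
  by apply/measurable_EFinP; exact: measurable_indic.
have := @integral_mulmx_tuple_swap n N f (fun t => (\1_B t)%:E) NNT mf mg f0
  (fun=> _).
have -> : \int[lebesgue_tuple R n]_x (\1_B (mulmx_tuple N x))%:E =
    \int[lebesgue_tuple R n]_x (\1_B x)%:E.
  apply: eq_integral => x _; rewrite !indicE; congr (nat_of_bool _)%:R%:E.
  by apply/idP/idP => /set_mem H; apply/mem_set; move: H; rewrite /B tuple_ball_mulmx.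
(* The common factor, the volume of the ball, is positive and finite and can be cancelled. *)
have /andP[B0 Boo] := lebesgue_tuple_ball n.
rewrite -lebesgue_tupleE// [RHS]muleC.
have Bf : lebesgue_tuple R n B \is a fin_num by rewrite ge0_fin_numE.
have : forall t, 0 <= (\1_B t)%:E :> \bar R by move=> t; rewrite lee_fin.
move=> /[swap] /[apply] /(congr1 (fun z => z * (fine (lebesgue_tuple R n B))^-1%:E)).
rewrite -(fineK Bf) -!muleA -EFinM/= divff ?mule1//.
by rewrite gt_eqF// fine_gt0// B0.
Qed.

End orthogonal_invariance.

(** * Second moment of the coordinate along the diagonal *)

Section second_moment.
Context {R : realType}.
Local Open Scope ereal_scope.

Local Notation Borel := (measurableTypeR R).
Local Notation mu := (@lebesgue_measure R).

Lemma integral_deriv_poly (p : {poly R}) (a b : R) : (a < b)%R ->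
  \int[mu]_(x in `[a, b]) (p^`()%R.[x])%:E = (p.[b] - p.[a])%:E.
Proof.
move=> ab; rewrite (@continuous_FTC2 _ _ (horner p))//.
- by apply: continuous_subspaceT; exact: continuous_horner.
- split; first by move=> x _; exact: derivable_horner.
  + by apply: cvg_at_right_filter; exact: continuous_horner.
  + by apply: cvg_at_left_filter; exact: continuous_horner.
- by move=> x _; rewrite derivE.
Qed.

(** A uniform variable on [0,1] has mean 1/2 and variance 1/12. The constant [k] makes room for the
    contribution of the other coordinates. *)
Lemma integral_sqr_unit_interval (a e k : R) :
  \int[mu]_(x in `[0%R, 1%R]) ((a + e * (x - 2^-1)) ^+ 2 + k)%:E =
  (a ^+ 2 + e ^+ 2 / 12 + k)%:E.
Proof.
(* An antiderivative of the integrand, expanded in powers of [a] and [e]. *)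
pose p : {poly R} := ((a ^+ 2 + k) *: 'X + (a * e) *: ('X ^+ 2 - 'X)
  + (e ^+ 2) *: (3^-1 *: 'X^3 - 2^-1 *: 'X^2 + 4^-1 *: 'X))%R.
transitivity (\int[mu]_(x in `[0%R, 1%R]) (p^`()%R.[x])%:E).
  apply: eq_integral => x _; congr (_%:E); rewrite /p !poly.derivE !hornerE/=.
  by field.
rewrite integral_deriv_poly//; congr (_%:E); rewrite /p !hornerE/=.
by field.
Qed.

Lemma measurable_deviation n (e : 'I_n -> R) (a : R) :
  measurable_fun setT
    (fun t : n.-tuple Borel => a + \sum_i e i * (tnth t i - 2^-1) : R)%R.
Proof.
apply: measurable_funD => //; apply: measurable_sum => i.
by apply: measurable_funM => //; apply: measurable_funB => //; exact: measurable_tnth.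
Qed.

(** The shift [a] is what the induction needs: with the first coordinate x fixed, the inner integral
    is the same statement with shift $a + e_0 (x - 1/2)$. *)
Lemma second_moment_unit_cube n (e : 'I_n -> R) (a : R) :
  \int[lebesgue_tuple R n]_t (\1_(tuple_box 0 1) t *
     (a + \sum_i e i * (tnth t i - 2^-1)) ^+ 2)%:E =
  (a ^+ 2 + \sum_i e i ^+ 2 / 12)%:E.
Proof.
have mf k (f : 'I_k -> R) (b : R) : measurable_fun setT
    (fun t : k.-tuple Borel => (\1_(tuple_box 0 1) t *
     (b + \sum_i f i * (tnth t i - 2^-1)) ^+ 2)%:E : \bar R).
  apply/measurable_EFinP; apply: measurable_funM.
    by apply: measurable_indic; exact: measurable_tuple_box.
  by apply: measurable_funX; exact: measurable_deviation.
have f0 k (f : 'I_k -> R) (b : R) (t : k.-tuple R) :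
    0 <= (\1_(tuple_box 0 1) t * (b + \sum_i f i * (tnth t i - 2^-1)) ^+ 2)%:E.
  by rewrite lee_fin mulr_ge0// sqr_ge0.
elim: n e a => [|n IH] e a.
  rewrite integral_lebesgue_tuple0// !big_ord0 !addr0 indicE mem_set ?mul1r//.
  by case.
rewrite integral_lebesgue_tupleS//.
pose S := (\sum_(i < n) e (lift ord0 i) ^+ 2 / 12)%R.
transitivity (\int[mu]_(x in `[0%R, 1%R]) ((a + e ord0 * (x - 2^-1)) ^+ 2 + S)%:E).
  rewrite [RHS]integral_mkcond; apply: eq_integral => x _.
  rewrite patchE; case: ifPn => xI.
    rewrite -(IH (e \o lift ord0)); apply: eq_integral => t _.
    rewrite big_ord_recl addrA/= (tnth_nth 0%R)/=.
    under eq_bigr do rewrite tnthS.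
    congr (_ * _)%:E; rewrite !indicE; congr (nat_of_bool _)%:R.
    move/set_mem : xI; rewrite /= in_itv/= => xI.
    apply/idP/idP => /set_mem H; apply/mem_set => i.
      by have := H (lift ord0 i); rewrite tnthS.
    by case: (unliftP ord0 i) => [j|] ->; rewrite ?tnthS.
  (* For x outside [0,1] no tuple beginning with x is in the box. *)
  rewrite integral0_eq// => t _; rewrite indicE memNset ?mul0r// => H.
  by move: xI; apply/negP/negPn/mem_set; rewrite /= in_itv; exact: (H ord0).
by rewrite integral_sqr_unit_interval big_ord_recl addrA.
Qed.

Definition deviation_set n (e : 'I_n -> R) (r : R) : set (n.-tuple Borel) :=
  tuple_box 0 1 `&` [set t | r <= `|\sum_i e i * (tnth t i - 2^-1)|]%R.

Lemma measurable_deviation_set n (e : 'I_n -> R) r :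
  measurable (deviation_set e r).
Proof.
apply: measurableI; first exact: measurable_tuple_box.
rewrite (_ : [set t | _] = (fun t : n.-tuple Borel =>
    `|0 + \sum_i e i * (tnth t i - 2^-1)|)%R @^-1` `[r, +oo[%classic); last first.
  by apply/seteqP; split => t /=; rewrite in_itv/= andbT add0r.
rewrite -[_ @^-1` _]setTI.
suff : measurable_fun setT (fun t : n.-tuple Borel =>
    `|0 + \sum_i e i * (tnth t i - 2^-1)| : R)%R by apply.
by apply: measurableT_comp => //; exact: measurable_deviation.
Qed.

(** With X the signed sum, $r^2 1_{|X| \ge r} \le X^2$ on the box; integrate and use the second
    moment with shift 0. *)
Lemma chebyshev_unit_cube n (e : 'I_n -> R) (r : R) : (0 <= r)%R ->
  (r ^+ 2)%:E * lebesgue_tuple R n (deviation_set e r) <=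
  (\sum_i e i ^+ 2 / 12)%:E.
Proof.
move=> r0; have mS := measurable_deviation_set e r.
have -> : (\sum_i e i ^+ 2 / 12 = 0 ^+ 2 + \sum_i e i ^+ 2 / 12)%R.
  by rewrite expr0n add0r.
rewrite -second_moment_unit_cube lebesgue_tupleE// -ge0_integralZl//; last 2 first.
- by apply/measurable_EFinP; exact: measurable_indic.
- by rewrite lee_fin sqr_ge0.
apply: ge0_le_integral => //.
- by move=> t _; rewrite -EFinM lee_fin mulr_ge0// sqr_ge0.
- by apply/measurable_EFinP; apply: measurable_funM.
- apply/measurable_EFinP; apply: measurable_funM.
    by apply: measurable_indic; exact: measurable_tuple_box.
  by apply: measurable_funX; exact: measurable_deviation.
move=> t _; rewrite -EFinM lee_fin add0r indicE.
have [/set_mem [tb tr]|_] := boolP (t \in deviation_set e r).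
  rewrite mulr1 indicE mem_set// mul1r -[leRHS]real_normK ?num_real//.
  by rewrite ler_sqr ?nnegrE.
by rewrite mulr0 mulr_ge0// sqr_ge0.
Qed.

End second_moment.

(** * Caps *)

Section inner_product.
Context {R : realType} (n : nat).
Implicit Types (x y z w : 'rV[R]_n) (M : 'M[R]_n).

Lemma dotpE x y : dotp x y = (x *m y^T) 0 0.
Proof. by rewrite mxE; apply: eq_bigr => i _; rewrite mxE. Qed.

Lemma dotpC x y : dotp x y = dotp y x.
Proof. by apply: eq_bigr => i _; rewrite mulrC. Qed.

Lemma dotpDl x y z : dotp (x + y) z = dotp x z + dotp y z.
Proof. by rewrite !dotpE mulmxDl mxE. Qed.

Lemma dotpZl k x y : dotp (k *: x) y = k * dotp x y.
Proof. by rewrite !dotpE -scalemxAl mxE. Qed.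

Lemma dotpBl x y z : dotp (x - y) z = dotp x z - dotp y z.
Proof. by rewrite dotpDl -scaleN1r dotpZl mulN1r. Qed.

Lemma dotpZr k x y : dotp x (k *: y) = k * dotp x y.
Proof. by rewrite dotpC dotpZl dotpC. Qed.

Lemma dotpBr x y z : dotp x (y - z) = dotp x y - dotp x z.
Proof. by rewrite dotpC dotpBl !(dotpC x). Qed.

Lemma dotpxx_eq0 x : (dotp x x == 0) = (x == 0).
Proof.
apply/eqP/eqP => [|->]; last by rewrite /dotp big1// => i _; rewrite mxE mul0r.
move=> /eqP; rewrite psumr_eq0 => [/allP H|i _]; last exact: sqr_ge0.
apply/rowP => i; rewrite mxE; apply/eqP.
by have := H i (mem_index_enum _); rewrite mulf_eq0 orbb.
Qed.

Lemma dotp_orthogonal M x y : M *m M^T = 1%:M -> dotp (x *m M) (y *m M) = dotp x y.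
Proof. by move=> MMT; rewrite !dotpE trmx_mul mulmxA -(mulmxA _ M) MMT mulmx1. Qed.

Lemma perpendicular_hyperplane w c a b : w != 0 ->
  perpendicular (hyperplane w c) a b -> exists k, b - a = k *: w.
Proof.
move=> w0 pw; have ww0 : dotp w w != 0 by rewrite dotpxx_eq0.
pose d := b - a; pose k := dotp d w / dotp w w; exists k.
(* [x] is the point of the hyperplane nearest the origin and [z] the part of [d] orthogonal to [w].
   As [x] and [x + z] both lie on the hyperplane, [z] is orthogonal to [d], hence to itself. *)
pose x := (c / dotp w w) *: w; pose z := d - k *: w.
have xw : dotp x w = c by rewrite dotpZl divfK.
have zw : dotp z w = 0 by rewrite dotpBl dotpZl divfK// subrr.
have zd : dotp z d = 0.
  rewrite -[z](addrK x) [z + x]addrC; apply: pw => //.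
  by rewrite /hyperplane/= dotpDl xw zw addr0.
apply/eqP; rewrite -subr_eq0 -dotpxx_eq0 -/d -/z.
by rewrite {2}/z dotpBr dotpZr zd zw mulr0 subr0.
Qed.

Lemma set_dist_le (A B : set 'rV[R]_n) x y :
  A x -> B y -> (set_dist A B <= (eucl_dist x y)%:E)%E.
Proof. by move=> Ax By; apply: ereal_inf_lbound; exists x, y. Qed.

End inner_product.

(** * Rigid coordinates on the cube *)

Section cube_coordinates.
Context {R : realType} (n : nat) (K : cube R n).

Local Notation Borel := (measurableTypeR R).
Local Notation row_of t := (\row_i tnth t i).

(** The scaling by [side K] is left out, so that this map is a rigid motion and preserves volume;
    the cube is then the image of $[0, side]^n$. *)
Definition cube_tuple (t : n.-tuple Borel) : n.-tuple Borel :=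
  translate_tuple (corner K 0) (mulmx_tuple (frame K) t).

Lemma row_cube_tuple t :
  row_of (cube_tuple t) = corner K + row_of t *m frame K.
Proof. by rewrite -row_mulmx_tuple; apply/rowP => i; rewrite !mxE tnth_mktuple. Qed.

Lemma measurable_cube_tuple : measurable_fun setT cube_tuple.
Proof.
exact: (measurableT_comp (measurable_translate_tuple _) (measurable_mulmx_tuple _)).
Qed.

Lemma measurable_cube_tuple_preimage (S : set (n.-tuple Borel)) :
  measurable S -> measurable (cube_tuple @^-1` S).
Proof. by move=> mS; rewrite -[_ @^-1` _]setTI; exact: measurable_cube_tuple. Qed.

Lemma volume_cube_tuple (S : set 'rV[R]_n) :
  measurable [set t : n.-tuple Borel | S (row_of t)] ->
  volume S = lebesgue_tuple R n (cube_tuple @^-1` [set t | S (row_of t)]).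
Proof.
move=> mS; rewrite /volume !lebesgue_tupleE//; last first.
  exact: measurable_cube_tuple_preimage.
set A := [set t | _]; have mA : measurable_fun setT (fun t => (\1_A t)%:E : \bar R).
  by apply/measurable_EFinP; apply: measurable_indic.
rewrite -(ge0_integral_translate_tuple (corner K 0) mA)//.
rewrite -(ge0_integral_mulmx_tuple (frame_orthogonal K))//.
exact: (measurableT_comp mA (measurable_translate_tuple _)).
Qed.

Lemma cube_tuple_cube t :
  cube_set K (row_of (cube_tuple t)) <-> tuple_box 0 (side K) t.
Proof.
have s0 := side_gt0 K; rewrite row_cube_tuple; split=> [[u u01]|tb].
  move=> /addrI /(congr1 (mulmx^~ (frame K)^T)).
  rewrite -scalemxAl -!mulmxA frame_orthogonal !mulmx1 => /rowP ut i.
  have /andP[u0 u1] := u01 i; have := ut i; rewrite !mxE => <-.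
  by rewrite mulr_ge0 ?(ltW s0)//= -[leRHS]mulr1 ler_pM2l.
exists ((side K)^-1 *: row_of t).
  move=> i; rewrite !mxE mulr_ge0 ?invr_ge0 ?(ltW s0)//=; last by have /andP[] := tb i.
  by rewrite mulrC ler_pdivrMr// mul1r; have /andP[] := tb i.
by rewrite /cube_point -scalemxAl scalerA divff ?gt_eqF// scale1r.
Qed.

(** An explicit right inverse; it exhibits the cube as the preimage of a box under a measurable
    map. *)
Lemma cube_tuple_surj t :
  cube_tuple (mulmx_tuple (frame K)^T
    (translate_tuple (fun i => - corner K 0 i) t)) = t.
Proof.
apply: row_tuple_inj; rewrite row_cube_tuple row_mulmx_tuple -mulmxA.
rewrite (mulmx1C (frame_orthogonal K)) mulmx1.
by apply/rowP => i; rewrite !mxE tnth_mktuple addNKr.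
Qed.

Lemma measurable_cube_set :
  measurable [set t : n.-tuple Borel | cube_set K (row_of t)].
Proof.
pose G t := mulmx_tuple (frame K)^T (translate_tuple (fun i => - corner K 0 i) t).
rewrite (_ : [set t | _] = G @^-1` tuple_box 0 (side K)).
  rewrite -[_ @^-1` _]setTI.
  apply: (measurableT_comp (measurable_mulmx_tuple _)
    (measurable_translate_tuple _)) => //.
  exact: measurable_tuple_box.
by apply/seteqP; split=> t /=; rewrite -cube_tuple_cube cube_tuple_surj.
Qed.

Lemma measurable_half_space (w : 'rV[R]_n) c H : half_space w c H ->
  measurable [set t : n.-tuple Borel | H (row_of t)].
Proof.
move=> [_ HE].
have mw : measurable_fun setT (fun t : n.-tuple Borel => dotp (row_of t) w : R).
  apply: measurable_sum => i; under eq_fun do rewrite mxE.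
  by apply: measurable_funM => //; exact: measurable_tnth.
case: HE => ->.
  rewrite (_ : [set t | _] = (fun t : n.-tuple Borel => dotp (row_of t) w)
    @^-1` `]-oo, c]%classic); last by apply/seteqP; split => t /=; rewrite in_itv.
  by rewrite -[_ @^-1` _]setTI; exact: mw.
rewrite (_ : [set t | _] = (fun t : n.-tuple Borel => dotp (row_of t) w)
  @^-1` `]-oo, c[%classic); last by apply/seteqP; split => t /=; rewrite in_itv.
by rewrite -[_ @^-1` _]setTI; exact: mw.
Qed.

Lemma side_of_unit_cube : (1 <= n)%N -> volume (cube_set K) = 1%:E -> side K = 1.
Proof.
move=> n1; rewrite volume_cube_tuple; last exact: measurable_cube_set.
rewrite (_ : _ @^-1` _ = tuple_box 0 (side K)); last first.
  by apply/seteqP; split => t /=; rewrite cube_tuple_cube.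
have s0 := side_gt0 K.
rewrite lebesgue_tuple_box ?(ltW s0)// subr0 => -[] /eqP.
by rewrite pexprn_eq1 ?(ltW s0)// => /orP[/eqP|/eqP//] n0; rewrite n0 in n1.
Qed.

(** * Points of the diagonal and the caps containing them *)

Definition diagonal_sign (v : {set 'I_n}) (i : 'I_n) : R := (-1) ^+ (i \in v).

Lemma diagonal_sign_sqr v i : diagonal_sign v i ^+ 2 = 1.
Proof. by rewrite -exprM mulnC exprM sqrrN expr1n expr1n. Qed.

Lemma sum_diagonal_sign_sqr v : \sum_i diagonal_sign v i ^+ 2 = n%:R.
Proof.
by under eq_bigr do rewrite diagonal_sign_sqr; rewrite sumr_const card_ord.
Qed.

(* [s = -1/2] and [s = 1/2] give the vertices [v] and [~: v] of a unit cube. *)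
Definition diagonal_point v (s : R) : 'rV[R]_n :=
  corner K + (\row_i (2^-1 + s * diagonal_sign v i)) *m frame K.

(** Going to the opposite vertex lowers the coordinates in [v] from 1 to 0 and raises the others
    from 0 to 1, whence the signs. *)
Lemma main_diagonal_direction (v : {set 'I_n}) :
  cube_vertex K (~: v)%SET - cube_vertex K v =
  side K *: ((\row_i diagonal_sign v i) *m frame K).
Proof.
rewrite /cube_vertex /cube_point opprD addrACA subrr add0r -scalerBr.
rewrite -mulmxBl; congr (_ *: (_ *m _)).
apply/rowP => i; rewrite !mxE /diagonal_sign inE.
by case: (i \in v); rewrite ?expr1 ?expr0/= ?subr0 ?sub0r.
Qed.

Lemma eucl_dist_diagonal_point v s s' :
  eucl_dist (diagonal_point v s) (diagonal_point v s') =
  `|s - s'| * Num.sqrt n%:R.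
Proof.
rewrite /eucl_dist /diagonal_point opprD addrACA subrr add0r -mulmxBl.
rewrite dotp_orthogonal ?frame_orthogonal// -sqrtr_sqr -sqrtrM ?sqr_ge0//.
congr Num.sqrt; rewrite -(sum_diagonal_sign_sqr v) mulr_sumr.
by apply: eq_bigr => i _; rewrite !mxE; ring.
Qed.

Context (side1 : side K = 1).

Lemma cube_set_diagonal_point v s : `|s| <= 2^-1 -> cube_set K (diagonal_point v s).
Proof.
move=> s2; exists (\row_i (2^-1 + s * diagonal_sign v i)).
  move=> i; rewrite !mxE.
  have : `|s * diagonal_sign v i| <= 2^-1.
    by rewrite normrM normrX normrN1 expr1n mulr1.
  by rewrite ler_norml => /andP[? ?]; apply/andP; split; lra.
by rewrite /cube_point side1 scale1r.
Qed.

(** Membership in [H] depends only on the signed sum X, which equals s n at [diagonal_point v s]. If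
    X(t) lies between -dn and dn, then one of the points at -d and d is at least as deep in [H] as
    the point of [t]. *)
Lemma deviation_half_space v (w : 'rV[R]_n) c H k (d : R) t :
  half_space w c H -> (\row_i diagonal_sign v i) *m frame K = k *: w ->
  (1 <= n)%N ->
  `|\sum_i diagonal_sign v i * (tnth t i - 2^-1)| <= d * n%:R ->
  H (row_of (cube_tuple t)) ->
  H (diagonal_point v d) \/ H (diagonal_point v (- d)).
Proof.
move=> [w0 HE] ekw n1 td.
(* If k = 0 the sign vector would vanish, yet its squared length is n. *)
have k0 : k != 0.
  apply: contraTneq n1 => k0; rewrite k0 scale0r in ekw.
  have := dotp_orthogonal (\row_i diagonal_sign v i) (\row_i diagonal_sign v i)
    (frame_orthogonal K).
  rewrite ekw -[in LHS](scale0r 0) dotpZl mul0r => /esym/eqP.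
  rewrite /dotp; under eq_bigr do rewrite mxE -expr2.
  by rewrite sum_diagonal_sign_sqr pnatr_eq0 => /eqP ->.
have dE s : dotp (diagonal_point v s) w = dotp (row_of (cube_tuple t)) w -
    k^-1 * (\sum_i diagonal_sign v i * (tnth t i - 2^-1) - s * n%:R).
  have -> : w = k^-1 *: ((\row_i diagonal_sign v i) *m frame K).
    by rewrite ekw scalerA mulVf// scale1r.
  apply/eqP; rewrite eq_sym subr_eq addrC -subr_eq -dotpBl dotpZr; apply/eqP.
  rewrite row_cube_tuple /diagonal_point opprD addrACA subrr add0r -mulmxBl.
  rewrite dotp_orthogonal ?frame_orthogonal//; congr (_ * _).
  rewrite -(sum_diagonal_sign_sqr v) mulr_sumr -sumrB.
  by apply: eq_bigr => i _; rewrite !mxE; ring.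
have [s [sd sle]] : exists s, (s = d \/ s = - d) /\
    dotp (diagonal_point v s) w <= dotp (row_of (cube_tuple t)) w.
  move: td; rewrite ler_norml => /andP[td1 td2].
  (* The sign of [k] tells in which direction along the diagonal the product with [w] decreases. *)
  case: (ltgtP k 0) k0 => // k0 _.
    exists d; split; first by left.
    by rewrite dE lerBlDr lerDl mulr_le0// ?invr_le0 ?(ltW k0)// subr_le0.
  exists (- d); split; first by right.
  by rewrite dE lerBlDr lerDl mulr_ge0// ?invr_ge0 ?(ltW k0)// subr_ge0 mulNr.
have Hs : H (row_of (cube_tuple t)) -> H (diagonal_point v s).
  by case: HE => -> /=; [exact: le_trans | exact: le_lt_trans].
by move=> /Hs; case: sd => ->; [left|right].
Qed.

(** If both points at parameter -d and d missed [A], all of [A] would satisfy |X| > dn. For d = 1/2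
    this leaves nothing of the cube; otherwise Chebyshev makes the volume of [A] too small. *)
Lemma cap_meets_diagonal v (A : set 'rV[R]_n) (eps d : R) : (1 <= n)%N ->
  perpendicular_cap K (cube_vertex K v) (cube_vertex K (~: v)%SET) A ->
  0 < eps -> volume A = eps%:E -> 0 <= d ->
  d = 2^-1 \/ d <= 2^-1 /\ 12^-1 < n%:R * d ^+ 2 * eps ->
  exists2 s, `|s| = d & A (diagonal_point v s).
Proof.
move=> n1 [w [c [H [hH pw AE]]]] e0 vA d0 hd.
have d2 : d <= 2^-1 by case: hd => [->//|[]].
have [k ekw] : exists k, (\row_i diagonal_sign v i) *m frame K = k *: w.
  have [k] := perpendicular_hyperplane hH.1 pw.
  by rewrite main_diagonal_direction side1 scale1r; exists k.
apply: contrapT => nA.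
have mA : measurable [set t : n.-tuple Borel | A (row_of t)].
  rewrite AE; apply: measurableI; first exact: measurable_cube_set.
  exact: measurable_half_space hH.
have far t : A (row_of (cube_tuple t)) -> tuple_box 0 1 t /\
    d * n%:R < `|\sum_i diagonal_sign v i * (tnth t i - 2^-1)|.
  rewrite AE => -[Kt Ht]; split; first by rewrite -side1; exact/cube_tuple_cube.
  rewrite ltNge; apply/negP => td.
  apply: nA; have [Hd|Hd] := deviation_half_space hH ekw n1 td Ht.
    exists d; first by rewrite ger0_norm.
    by rewrite AE; split => //; apply: cube_set_diagonal_point; rewrite ger0_norm.
  exists (- d); first by rewrite normrN ger0_norm.
  by rewrite AE; split => //; apply: cube_set_diagonal_point; rewrite normrN ger0_norm.
rewrite volume_cube_tuple// in vA.
case: hd => [dE|[_ hd]].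
  (* On the unit box each of the n terms of X is at most 1/2 in absolute value. *)
  have S0 : cube_tuple @^-1` [set t | A (row_of t)] = set0.
    apply/seteqP; split => // t /far[tb]; rewrite ltNge => /negP; apply.
    apply: le_trans (ler_norm_sum _ _ _) _.
    rewrite dE mulr_natr -[X in _ <= _ *+ X]card_ord -[leRHS]sumr_const.
    apply: ler_sum => i _.
    rewrite normrM normrX normrN1 expr1n mul1r ler_norml.
    by have /andP[? ?] := tb i; apply/andP; split; lra.
  by move: vA; rewrite S0 measure0 => -[] /esym /eqP; rewrite gt_eqF.
have r0 : 0 <= d * n%:R by rewrite mulr_ge0.
(* Chebyshev with r = dn would give $(dn)^2 \varepsilon \le n/12$, against [hd] after division by
   n. *)
have := chebyshev_unit_cube (diagonal_sign v) r0; apply/negP; rewrite -ltNge.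
apply: (@lt_le_trans _ _ (((d * n%:R) ^+ 2)%:E * eps%:E)%E); last first.
  have n0 : 0 < d.
    by rewrite lt_neqAle d0 andbT; apply: contraTneq hd => <-;
    rewrite expr0n mulr0 mul0r -leNgt invr_ge0.
  rewrite lee_pmul2l// ?lte_fin ?exprn_gt0 ?mulr_gt0 ?ltr0n//.
  rewrite -vA; apply: le_measure; rewrite ?inE//.
  - exact: measurable_cube_tuple_preimage.
  - exact: measurable_deviation_set.
  - by move=> t /far[tb /ltW].
rewrite -EFinM lte_fin -mulr_suml sum_diagonal_sign_sqr.
rewrite (_ : _ * eps = n%:R * (n%:R * d ^+ 2 * eps)); last by ring.
by rewrite ltr_pM2l ?ltr0n.
Qed.

End cube_coordinates.

Theorem mainTheorem2 (R : realType) (eps : R) (heps : 0 < eps < 1) :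
  exists D : R, forall (n : nat), (1 <= n)%N ->
    forall (K : cube R n) (a b : 'rV[R]_n) (A B : set 'rV[R]_n),
      volume (cube_set K) = 1%:E ->
      main_diagonal K a b ->
      perpendicular_cap K a b A -> perpendicular_cap K a b B ->
      volume A = eps%:E -> volume B = eps%:E ->
      (set_dist A B <= D%:E)%E.
Proof.
have /andP[e0 e1] := heps.
(* Each cap will contain a diagonal point within 1/eps of the centre, so the two points are at most
   2/eps apart. *)
exists (2 / eps) => n n1 K a b A B vK [v [-> ->]] capA capB vA vB.
have side1 := side_of_unit_cube n1 vK.
have sn0 : 0 < Num.sqrt n%:R :> R by rewrite sqrtr_gt0 ltr0n.
(* [d] is the smaller of 1/2 and $1/(\varepsilon \sqrt n)$; parameter d means distance $d \sqrt n$
   from the centre. *)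
have [d [d0 dn hd]] : exists d : R, [/\ 0 <= d, d * Num.sqrt n%:R <= eps^-1 &
    d = 2^-1 \/ d <= 2^-1 /\ 12^-1 < n%:R * d ^+ 2 * eps].
  have [small|large] := leP (2^-1 * Num.sqrt n%:R) eps^-1.
    by exists 2^-1; split => //; left.
  exists (eps^-1 / Num.sqrt n%:R); split.
  - by rewrite divr_ge0 ?invr_ge0 ?ltW.
  - by rewrite divfK// gt_eqF.
  - right; split; first by rewrite ler_pdivrMr// ltW.
    rewrite exprMn [(Num.sqrt _)^-1 ^+ 2]exprVn sqr_sqrtr ?ler0n//.
    (* For this d, $n d^2 \varepsilon = 1/\varepsilon > 1 > 1/12$. *)
    rewrite (_ : _ * eps = eps^-1); last first.
      by field; rewrite gt_eqF//= pnatr_eq0 -lt0n.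
    by apply: (@lt_trans _ _ 1); [lra | rewrite invf_gt1].
have [s sd As] := cap_meets_diagonal side1 n1 capA e0 vA d0 hd.
have [s' s'd Bs'] := cap_meets_diagonal side1 n1 capB e0 vB d0 hd.
apply: le_trans (set_dist_le As Bs') _; rewrite lee_fin eucl_dist_diagonal_point.
have : `|s - s'| <= 2 * d by apply: le_trans (ler_normB _ _) _; rewrite sd s'd; lra.
move=> /(ler_wpM2r (ltW sn0)) /le_trans; apply.
by rewrite -mulrA ler_pM2l.
Qed.
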